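(* Let $A$ be any algorithm with the following properties: $A$ is given $N$, an accuracy parameter $\epsilon>0$, distinct values $0\le a_1<a_2<a_3<a_4\in\mathbb{Z}$, and access to i.i.d. draws from an unknown $\{a_1,a_2,a_3,a_4\}$-sum $\mathbf{S}^*$; and with probability at least $9/10$ algorithm $A$ outputs a hypothesis distribution $\tilde{\mathbf{S}}$ such that $d_{TV}(\tilde{\mathbf{S}},\mathbf{S}^* )\le\epsilon$. Then there are infinitely many quadruples $(a_1,a_2,a_3,a_4)$ such that for sufficiently large $N$, $A$ must use $\Omega(\log\log a_4)$ samples even when run with $\epsilon$ set to a (suitably small) positive absolute constant.
   Context: For a finite set $\mathcal{A}\subset\mathbb{Z}_{\ge 0}$, an $\mathcal{A}$-sum is a distribution $\mathbf{S}=\mathbf{X}_1+\cdots+\mathbf{X}_N$ where the $\mathbf{X}_i$ are mutually independent (not necessarily identically distributed) integer random variables with $\bigcup_i\mathrm{supp}(\mathbf{X}_i)\subseteq\mathcal{A}$. $d_{TV}$ denotes total variation distance. *)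

(* Defs.v *)
From HB Require Import structures.
From mathcomp Require Import all_boot all_order all_algebra.
From mathcomp Require Import all_classical all_reals all_analysis.
Set Implicit Arguments.
Unset Strict Implicit.
Unset Printing Implicit Defensive.
Import Order.TTheory GRing.Theory Num.Theory.
Local Open Scope classical_set_scope.
Local Open Scope ring_scope.

Definition is_pmf (R : realType) (h : int -> R) : Prop :=
  (forall z, 0 <= h z) /\ (\esum_(z in [set: int]) (h z)%:E = 1)%E.

Definition dTV (R : realType) (h p : int -> R) : \bar R :=
  ((2^-1)%:E * \esum_(z in [set: int]) (`|h z - p z|)%:E)%E.

(* pmf of X_0 + ... + X_{n-1}, where the X_i are independent and X_i has
   pmf q i supported on the finite set A (a list of integers).  This is the
   iterated convolution; sumdist A q 0 is the point mass at 0. *)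
Fixpoint sumdist (R : realType) (A : seq int) (q : nat -> int -> R) (n : nat)
  : int -> R :=
  match n with
  | 0 => fun z => if z == 0 then 1 else 0
  | n'.+1 => fun z => \sum_(x <- undup A) q n' x * sumdist A q n' (z - x)
  end.

Definition is_Asum_family (R : realType) (A : seq int) (N : nat)
  (q : nat -> int -> R) : Prop :=
  forall i, (i < N)%N -> is_pmf (q i) /\ (forall z, z \notin A -> q i z = 0).

(* A randomized algorithm using m samples: internal randomness t drawn from
   a probability P on an arbitrary measurable space T; given the sample tuple
   s and t it outputs the hypothesis distribution alg s t.
   [learns A N eps P alg] : for every A-sum S* with N summands, with
   probability >= 9/10 (over m i.i.d. draws from S* and the internal coins)
   the output is eps-close to S* in total variation.  The success probability
   is taken in the inner-measure sense (measurable G s inside the success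
   set), which coincides with the usual probability for measurable algorithms. *)
Definition learns (R : realType) (A : seq int) (N : nat) (eps : R) (m : nat)
  (d : measure_display) (T : measurableType d) (P : probability T R)
  (alg : m.-tuple int -> T -> int -> R) : Prop :=
  (forall s t, is_pmf (alg s t)) /\
  forall q : nat -> int -> R, is_Asum_family A N q ->
    exists G : m.-tuple int -> set T,
      (forall s, measurable (G s) /\
         G s `<=` [set t | (dTV (alg s t) (sumdist A q N) <= eps%:E)%E]) /\
      ((9 / 10)%:E <=
        \esum_(s in [set: m.-tuple int])
          ((\prod_(i < m) sumdist A q N (tnth s i))%:E * P (G s)))%E.

(* Main.v *)
Require Import Defs.
From HB Require Import structures.
From mathcomp Require Import all_boot all_order all_algebra.
From mathcomp Require Import all_classical all_reals all_analysis.
From mathcomp Require Import zify ring lra.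
Set Implicit Arguments.
Unset Strict Implicit.
Unset Printing Implicit Defensive.
Import Order.TTheory GRing.Theory Num.Theory.
Import numFieldNormedType.Exports.
Local Open Scope ring_scope.

(**
Let q_0 = 0, q_1 = 1, q_(k+2) = 16 q_(k+1) - q_k, and take the quadruple
(0, 1, q_n, q_(n+1)) with p = q_(n+1).  For 1 <= k <= n let S_k = X + q_n Z + p Y
with independent X ~ Bin(2 q_(n-k+1)^2, 1/2), Z ~ Bin(2 q_k^2, 1/2), and
Y ~ Bin(W, 1/2) for one huge W common to all k.

All S_k have a pmf below a single function of total mass 576: modulo p the
lattice {(x, z) : p | x + q_n z} has no nonzero point in a box of dimensions
about q_(n-k+1) x q_k, so X + q_n Z has density O(1/p) modulo p, while Y is so
wide that carries are harmless.

The S_k are pairwise far in total variation: the character of frequency q_k / p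
has expectation near 1 in absolute value under S_k, because q_k q_n is congruent
to q_(n-k+1) modulo p, and small expectation under every other S_j.

If an algorithm learns each of the n hypotheses, its success events are disjoint
for a given sample, so domination by the common envelope gives
(9/10) n <= 576^m, that is m = Omega(log n) = Omega(log log p).
*)

(** * A negative continued fraction *)

(* The subtraction never truncates, see [qden_rec]. *)
Fixpoint qden (n : nat) : nat :=
  match n with
  | 0 => 0
  | n1.+1 => match n1 with 0 => 1 | n2.+1 => 16 * qden n1 - qden n2 end
  end%N.

Lemma qdenSS n : qden n.+2 = (16 * qden n.+1 - qden n)%N.
Proof. by []. Qed.

Lemma qden_grow n : (qden n * 15 <= qden n.+1)%N /\ (0 < qden n.+1)%N.
Proof. elim: n => [//|n [IH1 IH2]]; rewrite qdenSS; lia. Qed.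

Lemma qden_gt0 n : (0 < n)%N -> (0 < qden n)%N.
Proof. by case: n => // n _; case: (qden_grow n). Qed.

Lemma qden_rec n : (qden n.+2 + qden n = 16 * qden n.+1)%N.
Proof. by have := qden_grow n; rewrite qdenSS; lia. Qed.

Lemma qden_leS n : (qden n.+1 <= 16 * qden n + (n == 0))%N.
Proof. case: n => // n; have := qden_rec n; lia. Qed.

Lemma qden_mono : {homo qden : m n / (m <= n)%N}.
Proof.
move=> m n /subnK <-; elim: (n - m)%N => // k IH.
by apply: leq_trans IH _; rewrite addSn; have := qden_grow (k + m); lia.
Qed.

Lemma qden_le_exp n : (qden n <= 16 ^ n)%N.
Proof.
elim: n => // n IH; have := qden_leS n; rewrite expnS.
by case: n IH => [|n] /= IH; lia.
Qed.

Lemma qden_ge n : (n <= qden n)%N.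
Proof. by elim: n => // n IH; have := qden_grow n; lia. Qed.

(** Addition formula for continuants: for [k + l = n], [qden n.+1] is [qden l.+1 * qden k.+1] up to
    a much smaller correction. *)
Lemma qden_add k l : (qden (k + l).+1 + qden l * qden k = qden l.+1 * qden k.+1)%N.
Proof.
elim: k l => [|k IH] l; first by rewrite /= add0n; lia.
have := IH l.+1; rewrite addnS -addSn.
have := qden_rec k; have := qden_rec l.
move: (qden k) (qden k.+1) (qden k.+2) (qden l) (qden l.+1) (qden l.+2) (qden _) => a b c d e f g.
by nia.
Qed.

(** Modulo [qden (k + l).+1], multiplication by [qden (k + l)] sends [qden k.+1] to [qden l]. *)
Lemma qden_cross k l : (qden k.+1 * qden (k + l) = qden k * qden (k + l).+1 + qden l)%N.
Proof.
elim: k => [|k IH]; first by rewrite /= add0n; lia.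
have := qden_rec k; have := qden_rec (k + l); move: IH; rewrite addSn.
move: (qden k) (qden k.+1) (qden k.+2) (qden (k + l)) (qden (k + l).+1) (qden (k + l).+2) (qden l).
move=> a b c d e f g.
by nia.
Qed.

Lemma dvdz_small (p x : int) : (p %| x)%Z -> `|x| < p -> x = 0.
Proof.
move=> /dvdzP[c ->]; have [->|c0] := eqVneq c 0; first by rewrite mul0r.
rewrite normrM => h.
have c1 : 1 <= `|c| by lia.
have : `|p| <= `|c| * `|p| by rewrite ler_peMl.
lia.
Qed.

(** Multiplying the congruence by [qden k] and by [qden k.+1] and reducing with [qden_cross] gives
    two linear forms divisible by [p = qden (k + l).+1]. In the box both are smaller than [p], hence
    zero, and their determinant is [p] up to sign. *)
Lemma qden_box_proper (k l : nat) (x z : int) : (0 < k)%N ->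
  ((qden (k + l).+1)%:Z %| x + (qden (k + l))%:Z * z)%Z ->
  `|x| < (qden l.+1)%:Z - (qden l)%:Z -> `|z| < (qden k)%:Z -> x = 0 /\ z = 0.
Proof.
case: k => // k _ hd hx hz.
have hp := qden_add k.+1 l; have h1 := qden_cross k l.+1; have h2 := qden_cross k.+1 l.
have [g1 _] := qden_grow k.+1; have [g2 _] := qden_grow l.
rewrite addnS -addSn in h1.
move: hp h1 h2 g1 g2 hd hx hz.
move: (qden (k.+1 + l).+1) (qden (k.+1 + l)) (qden l.+1) (qden l) (qden k.+2) (qden k.+1) (qden k).
move=> p b A A' B' B C /(congr1 Posz) + /(congr1 Posz) + /(congr1 Posz).
rewrite !(PoszD, PoszM) => hp h1 h2 g1 g2 hd hx hz.
have hxA : `|x| * B%:Z <= (A%:Z - A'%:Z) * B%:Z by apply: ler_wpM2r => //; apply: ltW.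
have hxB : `|x| * B'%:Z <= (A%:Z - A'%:Z) * B'%:Z by apply: ler_wpM2r => //; apply: ltW.
have hzA : `|z| * A%:Z < B%:Z * A%:Z by rewrite ltr_pM2r //; lia.
have hzA' : `|z| * A'%:Z <= B%:Z * A'%:Z by apply: ler_wpM2r => //; apply: ltW.
have hAB : 15 * (B%:Z * A%:Z) <= B'%:Z * A%:Z.
  by rewrite mulrA; apply: ler_wpM2r => //; lia.
have hA'B : 15 * (B%:Z * A'%:Z) <= B'%:Z * A'%:Z.
  by rewrite mulrA; apply: ler_wpM2r => //; lia.
have hAA : A'%:Z * B%:Z <= A%:Z * B%:Z by apply: ler_wpM2r => //; lia.
have w0 : x * B%:Z + z * A%:Z = 0.
  apply: (@dvdz_small p).
    have -> : x * B%:Z + z * A%:Z = B%:Z * (x + b%:Z * z) - p%:Z * (C%:Z * z).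
      by rewrite mulrDr [B%:Z * (b%:Z * z)]mulrA h1; ring.
    by apply: rpredB; [exact: dvdz_mull|exact: dvdz_mulr].
  apply: le_lt_trans (ler_normD _ _) _.
  rewrite !normrM (ger0_norm (le0z_nat A)) (ger0_norm (le0z_nat B)).
  by lia.
have u0 : x * B'%:Z + z * A'%:Z = 0.
  apply: (@dvdz_small p).
    have -> : x * B'%:Z + z * A'%:Z = B'%:Z * (x + b%:Z * z) - p%:Z * (B%:Z * z).
      by rewrite mulrDr [B'%:Z * (b%:Z * z)]mulrA h2; ring.
    by apply: rpredB; [exact: dvdz_mull|exact: dvdz_mulr].
  apply: le_lt_trans (ler_normD _ _) _.
  rewrite !normrM (ger0_norm (le0z_nat A')) (ger0_norm (le0z_nat B')).
  (* For [l = 0] one has [A' = 0], so the term in [z] gives no strict inequality and strictness must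
     come from [x]. *)
  have hzB : `|x| * B'%:Z < (A%:Z - A'%:Z) * B'%:Z by rewrite ltr_pM2r //; lia.
  by lia.
have z0 : z = 0.
  have : z * p%:Z = 0.
    have -> : p%:Z = A%:Z * B'%:Z - A'%:Z * B%:Z by rewrite -hp; ring.
    have -> : z * (A%:Z * B'%:Z - A'%:Z * B%:Z)
      = B'%:Z * (x * B%:Z + z * A%:Z) - B%:Z * (x * B'%:Z + z * A'%:Z) by ring.
    by rewrite w0 u0 !mulr0 subr0.
  move=> /eqP; rewrite mulf_eq0 => /orP[/eqP//|/eqP p0].
  by exfalso; lia.
subst z; split => //; move: w0; rewrite mul0r addr0 => /eqP.
by rewrite mulf_eq0 => /orP[/eqP//|/eqP]; lia.
Qed.
(** * Binomial weights *)

Section Binomial.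
Variable R : realFieldType.

Definition bin_pmf (n x : nat) : R := 'C(n, x)%:R / 2 ^+ n.

Lemma bin_pmf_ge0 n x : 0 <= bin_pmf n x.
Proof. by rewrite divr_ge0 ?ler0n ?exprn_ge0. Qed.

Lemma bin_pmf_small n x : (n < x)%N -> bin_pmf n x = 0.
Proof. by move=> h; rewrite /bin_pmf bin_small // mul0r. Qed.

Lemma bin_pmfS0 n : bin_pmf n.+1 0 = bin_pmf n 0 / 2.
Proof. by rewrite /bin_pmf !bin0 exprSr invfM mulrA. Qed.

Lemma bin_pmfSS n x : bin_pmf n.+1 x.+1 = (bin_pmf n x.+1 + bin_pmf n x) / 2.
Proof. by rewrite /bin_pmf binS natrD exprSr invfM mulrA -mulrDl. Qed.

(** Conditioning on one coin, by Pascal's rule. *)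
Lemma sum_bin_pmfS n (g : nat -> R) :
  \sum_(x < n.+2) bin_pmf n.+1 x * g x
    = (\sum_(x < n.+1) bin_pmf n x * (g x + g x.+1)) / 2.
Proof.
rewrite big_ord_recl bin_pmfS0 /=.
under eq_bigr do rewrite /bump /= add1n bin_pmfSS mulrAC mulrDl.
rewrite -mulr_suml big_split /= mulrDl addrA.
under [in RHS]eq_bigr do rewrite mulrDr.
rewrite big_split /= [in RHS]mulrDl; congr (_ + _).
rewrite [X in _ + X / 2]big_ord_recr /= (@bin_pmf_small n n.+1) // mul0r addr0.
by rewrite [in RHS]big_ord_recl /= mulrDl mulrAC.
Qed.

Lemma sum_bin_pmf n : \sum_(x < n.+1) bin_pmf n x = 1.
Proof.
elim: n => [|n IH]; first by rewrite big_ord1 /bin_pmf bin0 expr0 divr1.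
transitivity (\sum_(x < n.+2) bin_pmf n.+1 x * 1).
  by apply: eq_bigr => x _; rewrite mulr1.
by rewrite (@sum_bin_pmfS n (fun=> 1)) -mulr_suml IH; lra.
Qed.

Lemma ler_sum_ord_support (F : nat -> R) m n : (forall x, 0 <= F x) ->
  (forall x, (n <= x)%N -> F x = 0) -> \sum_(x < m) F x <= \sum_(x < n) F x.
Proof.
move=> F0 Fn; rewrite -!(big_mkord xpredT F).
have [h|/ltnW h] := leqP m n.
  by rewrite [leRHS](@big_cat_nat _ _ _ m) //= lerDl sumr_ge0.
rewrite (@big_cat_nat _ _ _ n) //= gerDl [leLHS]big_nat_cond big1 //.
by move=> i /andP[/andP[hi _] _]; exact: Fn.
Qed.

Lemma sum_bin_pmf_le n X : \sum_(x < X) bin_pmf n x <= 1.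
Proof.
rewrite -(sum_bin_pmf n); apply: (@ler_sum_ord_support (bin_pmf n)).
  exact: bin_pmf_ge0.
by move=> x; apply: bin_pmf_small.
Qed.

(** [n - 2 x] is a sum of [n] independent signs, of mean 0 and variance [n]. The shift [c] is
    general so that the induction can absorb one sign into it. *)
Lemma bin_pmf_second_moment n (c : R) :
  \sum_(x < n.+1) bin_pmf n x * (n%:R - 2 * x%:R + c) ^+ 2 = n%:R + c ^+ 2.
Proof.
elim: n c => [|n IH] c.
  rewrite big_ord1 /bin_pmf bin0 expr0 divr1 /=; ring.
rewrite (@sum_bin_pmfS n (fun x => (n.+1%:R - 2 * x%:R + c) ^+ 2)).
under eq_bigr => x _.
  have -> : bin_pmf n x * ((n.+1%:R - 2 * x%:R + c) ^+ 2 + (n.+1%:R - 2 * x.+1%:R + c) ^+ 2)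
    = bin_pmf n x * (n%:R - 2 * x%:R + (c + 1)) ^+ 2
      + bin_pmf n x * (n%:R - 2 * x%:R + (c - 1)) ^+ 2.
    by rewrite -!natr1; ring.
  over.
by rewrite big_split /= !IH -natr1; field.
Qed.

Lemma bin_pmf_diff n x :
  bin_pmf n x.+1 - bin_pmf n x
    = 2 / n.+1%:R * (bin_pmf n.+1 x.+1 * (n.+1%:R - 2 * x.+1%:R)).
Proof.
have n0 : n.+1%:R != 0 :> R by rewrite pnatr_eq0.
have h : bin_pmf n x = 2 / n.+1%:R * (x.+1%:R * bin_pmf n.+1 x.+1).
  have e : x.+1%:R * 'C(n.+1, x.+1)%:R = n.+1%:R * 'C(n, x)%:R :> R.
    by rewrite -!natrM -mul_bin_diag.
  rewrite /bin_pmf exprS [x.+1%:R * _]mulrA.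
  have e0 : (2 : R) ^+ n != 0 by rewrite expf_neq0 // pnatr_eq0.
  move: (n.+1%:R : R) n0 e => N n0 e; rewrite e.
  by field; rewrite n0 e0.
have h2 : bin_pmf n x.+1 = 2 * bin_pmf n.+1 x.+1 - bin_pmf n x.
  by rewrite bin_pmfSS; field.
by rewrite h2 h; move: (n.+1%:R : R) n0 => N n0; field.
Qed.

(* [|t| <= (t ^ 2 / a + a) / 2] turns the second moment into a bound on the
   first absolute moment, to which [bin_pmf_diff] reduces the variation. *)
Lemma bin_pmf_variation n X (a : R) : 0 < a -> a ^+ 2 <= n.+1%:R ->
  \sum_(x < X) `|bin_pmf n x.+1 - bin_pmf n x| <= 2 / a.
Proof.
move=> a0 han.
have N0 : 0 < n.+1%:R :> R by rewrite ltr0n.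
pose F y : R := bin_pmf n.+1 y * `|n.+1%:R - 2 * y%:R|.
have F0 y : 0 <= F y by rewrite mulr_ge0 ?bin_pmf_ge0.
have FE x : `|bin_pmf n x.+1 - bin_pmf n x| = 2 / n.+1%:R * F x.+1.
  have h : 0 <= 2 / n.+1%:R :> R by rewrite divr_ge0.
  by rewrite bin_pmf_diff normrM (ger0_norm h) normrM (ger0_norm (bin_pmf_ge0 _ _)).
under eq_bigr do rewrite FE.
rewrite -mulr_sumr.
have hF : \sum_(x < X) F x.+1 <= a^-1 * n.+1%:R / 2 + a / 2.
  apply: (@le_trans _ _ (\sum_(y < n.+2) F y)).
    apply: (@le_trans _ _ (\sum_(y < X.+1) F y)).
      by rewrite big_ord_recl lerDr.
    apply: ler_sum_ord_support => // x hx.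
    by rewrite /F bin_pmf_small // mul0r.
  have step (y : nat) : F y <= a^-1 / 2 * (bin_pmf n.+1 y * (n.+1%:R - 2 * y%:R + 0) ^+ 2)
      + a / 2 * bin_pmf n.+1 y.
    rewrite addr0 /F -(real_normK (num_real (n.+1%:R - 2 * y%:R))).
    move: (`|_|) => t.
    rewrite [X in X + _]mulrCA [X in _ + X]mulrC -mulrDr.
    apply: ler_wpM2l; first exact: bin_pmf_ge0.
    rewrite -subr_ge0.
    have -> : a^-1 / 2 * t ^+ 2 + a / 2 - t = (t - a) ^+ 2 / (2 * a) by field; rewrite gt_eqF.
    by rewrite divr_ge0 ?sqr_ge0 // ltW // mulr_gt0.
  apply: (le_trans (ler_sum _ (fun (y : 'I_n.+2) _ => step y))).
  rewrite big_split /= -!mulr_sumr bin_pmf_second_moment sum_bin_pmf.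
  by rewrite expr0n /= addr0 mulr1 mulrAC.
apply: (@le_trans _ _ (2 / n.+1%:R * (a^-1 * n.+1%:R / 2 + a / 2))).
  by apply: ler_wpM2l hF; rewrite divr_ge0 // ltW.
have -> : 2 / n.+1%:R * (a^-1 * n.+1%:R / 2 + a / 2) = a^-1 + a ^+ 2 / n.+1%:R / a.
  by move: (n.+1%:R : R) N0 => N N0; field; rewrite gt_eqF // gt_eqF.
rewrite [2 / a]mulrDl mul1r lerD2l -[leRHS]mul1r; apply: ler_wpM2r; first by rewrite invr_ge0 ltW.
by rewrite ler_pdivrMr // mul1r.
Qed.

End Binomial.
(** * Sums over sparse sets *)

Section Smoothing.
Variable R : realFieldType.
Implicit Type P f : nat -> R.

Lemma ler_variation P x u : (x <= u)%N ->
  P x <= P u + \sum_(x <= r < u) `|P r.+1 - P r|.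
Proof.
move=> xu; rewrite -lerBlDl -(opprB (P u)) -(telescope_sumr P xu) -sumrN.
by apply: ler_sum => i _; rewrite -normrN ler_norm.
Qed.

(** Averages of this over windows of length [A] dominate [P], while for binomial weights its total
    stays bounded if [A] is at most of the order of the standard deviation. *)
Definition smooth (A : nat) P u : R := P u + A%:R * `|P u.+1 - P u|.

(** [P x] is at most [P u] plus the variation across the window; this is averaged over the [A]
    choices of [u]. *)
Lemma ler_smooth (A : nat) P x : (0 < A)%N ->
  P x <= (\sum_(x <= u < x + A) smooth A P u) / A%:R.
Proof.
move=> A0; rewrite ler_pdivlMr ?ltr0n // mulr_natr.
have -> : P x *+ A = \sum_(x <= u < x + A) P x.
  by rewrite sumr_const_nat addKn.
have -> : \sum_(x <= u < x + A) smooth A P u =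
   \sum_(x <= u < x + A) (P u + \sum_(x <= r < x + A) `|P r.+1 - P r|).
  by rewrite !big_split /= sumr_const_nat addKn -mulr_sumr mulr_natl.
rewrite big_nat_cond [leRHS]big_nat_cond; apply: ler_sum => u /andP[/andP[h1 h2] _].
apply: (le_trans (ler_variation P h1)); rewrite lerD2l.
rewrite [leRHS](@big_cat_nat _ _ _ u) //=; last exact: ltnW.
by rewrite lerDl sumr_ge0.
Qed.

Lemma sum_bool_le1 (T : finType) (c : pred T) :
  (forall i j, c i -> c j -> i = j) -> \sum_i (c i)%:R <= 1 :> R.
Proof.
move=> h; case: (pickP c) => [i ci|c0]; last by rewrite big1 // => i _; rewrite c0.
rewrite (bigD1 i) //= ci big1 ?addr0 // => j ji.
by case cj: (c j) => //; move: ji; rewrite (h _ _ cj ci) eqxx.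
Qed.

Lemma sum_window (f : nat -> R) (A X x : nat) : (x < X)%N ->
  \sum_(x <= u < x + A) f u = \sum_(u < X + A) (x <= u < x + A)%N%:R * f u.
Proof.
move=> xX; rewrite -(big_mkord xpredT (fun u => (x <= u < x + A)%N%:R * f u)).
rewrite [RHS](@big_cat_nat _ _ _ x) //=; last lia.
rewrite [X in _ = _ + X](@big_cat_nat _ _ _ (x + A)%N x) //=; [|lia|lia].
rewrite [X in _ = X + _]big_nat_cond [X in _ = X + _]big1 ?add0r; last first.
  by move=> i /andP[/andP[_ h] _]; rewrite leqNgt h /= mul0r.
rewrite [X in _ = _ + X]big_nat_cond [X in _ = _ + X]big1 ?addr0; last first.
  by move=> i /andP[/andP[h _] _]; rewrite [(i < _)%N]ltnNge h andbF mul0r.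
by apply: eq_big_nat => i /andP[h1 h2]; rewrite h1 h2 mul1r.
Qed.

(* Each product of two window averages is charged to points of the window, and
   every point is charged at most once since [D] meets each window at most once. *)
Lemma ler_sum_sparse (P1 P2 f1 f2 : nat -> R) (A B X Z : nat) (D : nat -> nat -> bool) :
  (0 < A)%N -> (0 < B)%N ->
  (forall x, 0 <= P1 x) -> (forall x, 0 <= P2 x) ->
  (forall x, 0 <= f1 x) -> (forall x, 0 <= f2 x) ->
  (forall x, P1 x <= (\sum_(x <= u < x + A) f1 u) / A%:R) ->
  (forall x, P2 x <= (\sum_(x <= u < x + B) f2 u) / B%:R) ->
  (forall x x' z z', D x z -> D x' z' ->
     `|x%:Z - x'%:Z| < A%:Z -> `|z%:Z - z'%:Z| < B%:Z -> x = x' /\ z = z') ->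
  \sum_(x < X) \sum_(z < Z) (D x z)%:R * (P1 x * P2 z) <=
  (\sum_(u < X + A) f1 u) * (\sum_(v < Z + B) f2 v) / (A * B)%:R.
Proof.
move=> A0 B0 P10 P20 f10 f20 hP1 hP2 hD.
pose I (i : 'I_X * 'I_Z) (j : 'I_(X + A) * 'I_(Z + B)) :=
  [&& D i.1 i.2, (i.1 <= j.1 < i.1 + A)%N & (i.2 <= j.2 < i.2 + B)%N].
have AB0 : 0 < (A * B)%:R :> R by rewrite ltr0n muln_gt0 A0.
rewrite pair_bigA /=.
apply: (@le_trans _ _ (\sum_(i : 'I_X * 'I_Z) \sum_(j : 'I_(X + A) * 'I_(Z + B))
   (I i j)%:R * (f1 j.1 * f2 j.2 / (A * B)%:R))).
  apply: ler_sum => -[x z] _ /=.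
  case Dxz: (D x z); last first.
    by rewrite mul0r sumr_ge0 // => j _; rewrite !mulr_ge0 // invr_ge0 ltW.
  rewrite mul1r.
  apply: (le_trans (ler_pM (P10 x) (P20 z) (hP1 x) (hP2 z))).
  rewrite (sum_window _ _ (ltn_ord x)) (sum_window _ _ (ltn_ord z)).
  rewrite mulrACA -invfM -natrM big_distrlr /= pair_bigA /= mulr_suml.
  apply: ler_sum => -[u v] _ /=; rewrite /I /= Dxz /=.
  by rewrite mulrACA -natrM mulnb -[X in X <= _]mulrA.
rewrite exchange_big /=.
rewrite big_distrlr /= [X in _ <= X / _]pair_bigA /= [leRHS]mulr_suml.
apply: ler_sum => -[u v] _ /=; rewrite -mulr_suml -[leRHS]mul1r; apply: ler_wpM2r.
  by rewrite !mulr_ge0 // invr_ge0 ltW.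
apply: (@sum_bool_le1 _ (fun i => I i (u, v))) => -[x z] [x' z'].
rewrite /I /= => /and3P[d1 h1 h2] /and3P[d2 h3 h4].
have [] := hD _ _ _ _ d1 d2; [lia|lia|].
by move=> /val_inj -> /val_inj ->.
Qed.

Lemma sum_divn (F : nat -> R) (p V : nat) : (0 < p)%N ->
  \sum_(s < p * V) F (s %/ p)%N = p%:R * \sum_(v < V) F v.
Proof.
move=> p0; elim: V => [|V IH]; first by rewrite muln0 !big_ord0 mulr0.
rewrite mulnS addnC big_split_ord /= IH big_ord_recr mulrDr; congr (_ + _).
under eq_bigr => i _ do rewrite mulnC divnMDl // divn_small // addn0.
by rewrite sumr_const card_ord mulr_natl.
Qed.

(** For [v <= X], a majorant of the maximum of [P] over [[v - U, v]]; unlike the maximum it is easy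
    to sum over [v]. *)
Definition shift_max (U X : nat) P v : R :=
  P v + \sum_(x < X) (x <= v <= x + U)%N%:R * `|P x.+1 - P x|.

Lemma ler_shift_max U X P y v : (y <= v <= y + U)%N -> (v <= X)%N ->
  P y <= shift_max U X P v.
Proof.
move=> /andP[yv vU] vX; apply: le_trans (ler_variation P yv) _; rewrite lerD2l.
rewrite -(big_mkord xpredT (fun x => (x <= v <= x + U)%N%:R * `|P x.+1 - P x|)).
rewrite [leRHS](@big_cat_nat _ _ _ y) //=; last lia.
rewrite [X in _ <= _ + X](@big_cat_nat _ _ _ v y) //= addrCA.
set S := (X in X <= _); set S' := (X in _ <= X + _).
have -> : S = S'.
  apply: eq_big_nat => x hx; have -> : (x <= v <= x + U)%N by lia.
  by rewrite mul1r.
by rewrite lerDl addr_ge0 // sumr_ge0 // => i _; rewrite mulr_ge0.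
Qed.

(** Each increment is counted for at most [U + 1] values of [v]. *)
Lemma sum_shift_max U X P V :
  \sum_(v < V) shift_max U X P v <=
  \sum_(v < V) P v + U.+1%:R * \sum_(x < X) `|P x.+1 - P x|.
Proof.
rewrite big_split /= lerD2l exchange_big /= mulr_sumr; apply: ler_sum => x _.
rewrite -mulr_suml; apply: ler_wpM2r => //.
rewrite -(big_mkord xpredT (fun v => (x <= v <= x + U)%N%:R)).
rewrite -natr_sum ler_nat.
suff -> : (\sum_(0 <= v < V) (x <= v <= x + U) = minn (V - x) U.+1)%N by lia.
elim: V => [|V IH]; first by rewrite big_geq //; lia.
by rewrite big_nat_recr //= IH; lia.
Qed.

End Smoothing.

(** * Sums of independent fair coins *)

Section CoinSums.
Variable R : realFieldType.
Implicit Types (ws : seq nat) (f g : nat -> R).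

(* Expectation of [f] at the sum of independent variables, the i-th of which
   is 0 or [nth 0 ws i] with probability 1/2 each. *)
Fixpoint coinE ws f : R :=
  match ws with
  | [::] => f 0%N
  | w :: ws' => (coinE ws' f + coinE ws' (fun t => f (t + w)%N)) / 2
  end.

Lemma eq_coinE ws f g : (forall t, (t <= sumn ws)%N -> f t = g t) ->
  coinE ws f = coinE ws g.
Proof.
elim: ws f g => [|w ws IH] f g h /=; first exact: h.
by congr ((_ + _) / 2); apply: IH => t ht; apply: h => /=; lia.
Qed.

Lemma coinE_ge0 ws f : (forall t, 0 <= f t) -> 0 <= coinE ws f.
Proof.
elim: ws f => [|w ws IH] f h //=.
by rewrite divr_ge0 // addr_ge0 //; apply: IH.
Qed.

Lemma coinE_sumZ ws (I : Type) (r : seq I) (c : I -> R) (F : I -> nat -> R) :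
  coinE ws (fun t => \sum_(i <- r) c i * F i t) = \sum_(i <- r) c i * coinE ws (F i).
Proof.
elim: ws F => [|w ws IH] F //=.
rewrite IH (IH (fun i t => F i (t + w)%N)) -big_split /= mulr_suml.
by apply: eq_bigr => i _; rewrite -mulrDr mulrA.
Qed.

Lemma coinE_nseq0 n ws f : coinE (nseq n 0%N ++ ws) f = coinE ws f.
Proof.
elim: n f => [|n IH] f //=; rewrite !IH.
rewrite (@eq_coinE ws (fun t => f (t + 0)%N) f); first by field.
by move=> t _; rewrite addn0.
Qed.

Lemma coinE_nseq n w ws f :
  coinE (nseq n w ++ ws) f =
  \sum_(x < n.+1) bin_pmf R n x * coinE ws (fun t => f (t + w * x)%N).
Proof.
elim: n f => [|n IH] f.
  rewrite big_ord1 /bin_pmf bin0 expr0 divr1 mul1r /=.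
  by apply: eq_coinE => t _; rewrite muln0 addn0.
rewrite (@sum_bin_pmfS _ n (fun x => coinE ws (fun t => f (t + w * x)%N))) /= !IH.
rewrite -big_split /=; congr (_ / _); apply: eq_bigr => x _.
rewrite -mulrDr; congr (_ * (_ + _)).
by apply: eq_coinE => t _; congr f; rewrite mulnS; lia.
Qed.

Definition coin_pmf ws (z : int) : R := coinE ws (fun t => (t%:Z == z)%:R).

Lemma coin_pmf_ge0 ws z : 0 <= coin_pmf ws z.
Proof. by apply: coinE_ge0 => t; rewrite ler0n. Qed.

Lemma coin_pmf_out ws z : ~~ (0 <= z <= (sumn ws)%:Z) -> coin_pmf ws z = 0.
Proof.
move=> hz; rewrite /coin_pmf (@eq_coinE _ _ (fun=> 0)).
  by elim: (ws) => //= w ws' ->; rewrite addr0 mul0r.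
by move=> t ht; case: eqP => // ?; lia.
Qed.

Lemma sum_coin_pmf ws f S : (sumn ws < S)%N ->
  \sum_(i < S) f i * coin_pmf ws i%:Z = coinE ws f.
Proof.
move=> hS; rewrite -(@coinE_sumZ ws _ _ (fun i : 'I_S => f i) (fun i t => (t%:Z == i%:Z)%:R)).
apply: eq_coinE => t ht.
have tS : (t < S)%N by lia.
rewrite (bigD1 (Ordinal tS)) //= eqxx mulr1 big1 ?addr0 // => i.
rewrite -val_eqE /= => hi; rewrite eqz_nat eq_sym (negbTE hi) mulr0 //.
Qed.

(** Multiples of [p] reach [s] from the offset [c] only at the quotient [y0 = (s - c) / p]. Since
    [c <= U], [s %/ p] lies between [y0] and [y0 + U], so the [shift_max] factor can be free of
    [c]. *)
Lemma coinE_nseq_le_shift_max (W p c U X s : nat) : (0 < p)%N ->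
  (c <= U)%N -> (s %/ p <= X)%N ->
  coinE (nseq W p) (fun t => (t + c == s)%N%:R) <=
  ((c <= s) && (p %| s - c))%N%:R * shift_max U X (bin_pmf R W) (s %/ p).
Proof.
move=> p0 cU sX; rewrite -[nseq W p]cats0 coinE_nseq /=.
case: (boolP ((c <= s) && (p %| s - c))%N) => [/andP[cs /dvdnP[y0 hy]]|hN].
  rewrite mul1r.
  apply: (@le_trans _ _ (\sum_(x < W.+1) bin_pmf R W y0 * (val x == y0)%:R)).
    apply: ler_sum => x _; rewrite add0n.
    have [->|xy] := eqVneq (val x) y0; first by rewrite mulr1 ler_piMr ?bin_pmf_ge0 // lern1 leq_b1.
    rewrite mulr0; case: eqP => [e|]; last by rewrite mulr0.
    exfalso; move/eqP: xy; apply; apply/eqP.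
    by rewrite -(eqn_pmul2l p0) [(p * y0)%N]mulnC -hy -e addnK.
  rewrite -mulr_sumr.
  apply: (@le_trans _ _ (bin_pmf R W y0)).
    rewrite ler_piMr ?bin_pmf_ge0 //.
    apply: (@sum_bool_le1 _ _ (fun x : 'I_W.+1 => val x == y0)) => i j /eqP hi /eqP hj.
    by apply: val_inj; rewrite hi.
  apply: ler_shift_max => //.
  have -> : s = (y0 * p + c)%N by lia.
  rewrite divnMDl // leq_addr leq_add2l /=.
  by apply: leq_trans (leq_div _ _) cU.
rewrite mul0r big1 // => x _; rewrite add0n; case: eqP => [e|]; last by rewrite mulr0.
by exfalso; move/negP: hN; apply; rewrite -e addnK leq_addl dvdn_mulr.
Qed.

End CoinSums.

(** * The hypotheses and their common envelope *)

(** The first two counts give standard deviations of the order of the sides of the box in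
    [qden_box_proper]. The factors 2 make these counts even, so that only squares of cosines occur
    in [prod_cos_hyp]. *)
Definition hyp_steps (W n k : nat) : seq nat :=
  nseq (2 * qden (n - k).+1 ^ 2) 1%N ++ nseq (2 * qden k ^ 2) (qden n) ++ nseq W (qden n.+1).

(** With [p = qden n.+1], each of the two terms is at most [2 p ^ 3]. *)
Lemma hyp_cross_sum n k x z : (k <= n)%N ->
  (x <= 2 * qden (n - k).+1 ^ 2)%N -> (z <= 2 * qden k ^ 2)%N ->
  (1 * x + qden n * z <= 4 * qden n.+1 ^ 3)%N.
Proof.
move=> kn hx hz.
have h1 : (qden (n - k).+1 <= qden n.+1)%N by apply: qden_mono; lia.
have h2 : (qden k <= qden n.+1)%N by apply: qden_mono; lia.
have h3 : (qden n <= qden n.+1)%N by apply: qden_mono.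
have h0 : (0 < qden n.+1)%N by apply: qden_gt0.
have := leq_mul h1 h1; have := leq_mul h3 (leq_mul h2 h2).
have := leq_mul (leqnn (qden n)) hz.
move: hx; rewrite !expnS !expn0 !muln1.
have : (qden n.+1 * qden n.+1 <= qden n.+1 * (qden n.+1 * qden n.+1))%N by rewrite leq_pmull.
rewrite !(mulnCA _ 2).
by lia.
Qed.

Lemma sumn_hyp W n k : (k <= n)%N ->
  (sumn (hyp_steps W n k) <= 4 * qden n.+1 ^ 3 + qden n.+1 * W)%N.
Proof.
move=> kn; rewrite /hyp_steps !sumn_cat !sumn_nseq addnA leq_add2r.
exact: (hyp_cross_sum kn).
Qed.

Section Domination.
Variable R : realFieldType.

Lemma smooth_ge0 A P u : (forall x : nat, 0 <= P x :> R) -> 0 <= smooth A P u.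
Proof. by move=> P0; rewrite addr_ge0 // mulr_ge0. Qed.

(** The mass contributes at most 1 and the variation at most [A * (2 / a) <= 2]. *)
Lemma sum_smooth_bin_pmf (A a n X : nat) : (0 < a)%N -> (A <= a)%N -> (a ^ 2 <= n.+1)%N ->
  \sum_(u < X) smooth A (bin_pmf R n) u <= 3.
Proof.
move=> a0 Aa an; rewrite big_split /= -mulr_sumr.
have -> : 3 = 1 + 2 :> R by ring.
apply: lerD; first exact: sum_bin_pmf_le.
have a0' : 0 < a%:R :> R by rewrite ltr0n.
apply: (@le_trans _ _ (A%:R * (2 / a%:R))).
  by apply: ler_wpM2l => //; apply: bin_pmf_variation => //; rewrite -natrX ler_nat.
by rewrite mulrA ler_pdivrMr // mulrC ler_wpM2l // ler_nat.
Qed.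

(** The steps [p = qden n.+1] contribute a [shift_max] factor independent of [x] and [z]. What
    remains is the mass of the pairs with [p] dividing [s - (x + qden n * z)]; these are sparse by
    [qden_box_proper], so [ler_sum_sparse] bounds it by [3 * 3 / (A * qden k)]. *)
Lemma hyp_dominated (W n k X s : nat) : (0 < k <= n)%N -> (s %/ qden n.+1 <= X)%N ->
  coin_pmf R (hyp_steps W n k) s%:Z <=
  288 / (qden n.+1)%:R * shift_max (4 * qden n.+1 ^ 3) X (bin_pmf R W) (s %/ qden n.+1).
Proof.
move=> /andP[k0 kn] sX; rewrite /coin_pmf /hyp_steps coinE_nseq.
have p0 : (0 < qden n.+1)%N by apply: qden_gt0.
set U := (4 * _)%N; set M := shift_max _ _ _ _.
have M0 : 0 <= M.
  by rewrite addr_ge0 ?bin_pmf_ge0 // sumr_ge0 // => i _; rewrite mulr_ge0.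
set n1 := (2 * _)%N; set n2 := (2 * qden k ^ 2)%N.
pose D (x z : nat) := ((1 * x + qden n * z <= s) && (qden n.+1 %| s - (1 * x + qden n * z)))%N.
apply: (@le_trans _ _ (M * \sum_(x < n1.+1) \sum_(z < n2.+1)
    (D x z)%:R * (bin_pmf R n1 x * bin_pmf R n2 z))).
  rewrite mulr_sumr; apply: ler_sum => x _.
  rewrite coinE_nseq !mulr_sumr; apply: ler_sum => z _.
  rewrite mulrA mulrC [leRHS]mulrA [leRHS]mulrC [M * _]mulrC.
  rewrite [leRHS]mulrC; apply: ler_wpM2r; first by rewrite mulr_ge0 ?bin_pmf_ge0.
  have hc : (1 * x + qden n * z <= U)%N by apply: (hyp_cross_sum kn); rewrite -ltnS.
  apply: le_trans (@coinE_nseq_le_shift_max R W _ _ _ _ s p0 hc sX).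
  rewrite (@eq_coinE _ _ _ (fun t : nat => (t + (1 * x + qden n * z) == s)%N%:R)) //.
  by move=> t _; rewrite eqz_nat; congr ((_ == _)%:R); lia.
rewrite mulrC; apply: ler_wpM2r => //.
set l := (n - k)%N.
have [g1 g1'] := qden_grow l.
pose A := (qden l.+1 - qden l)%N.
have A0 : (0 < A)%N by rewrite /A; lia.
have B0 : (0 < qden k)%N by apply: qden_gt0.
have nE : (k + l = n)%N by rewrite /l; lia.
apply: le_trans.
  apply: (@ler_sum_sparse _ _ _
    (smooth A (bin_pmf R n1)) (smooth (qden k) (bin_pmf R n2)) A (qden k)) => //.
  - exact: bin_pmf_ge0.
  - exact: bin_pmf_ge0.
  - by move=> x; apply: smooth_ge0; apply: bin_pmf_ge0.
  - by move=> x; apply: smooth_ge0; apply: bin_pmf_ge0.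
  - by move=> x; apply: ler_smooth.
  - by move=> x; apply: ler_smooth.
  move=> x x' z z' /andP[c1 d1] /andP[c2 d2] hx hz.
  have [] := @qden_box_proper k l (x%:Z - x'%:Z) (z%:Z - z'%:Z) k0 _ _ hz.
  - rewrite nE.
    have -> : x%:Z - x'%:Z + (qden n)%:Z * (z%:Z - z'%:Z) =
      (s - (1 * x' + qden n * z'))%N%:Z - (s - (1 * x + qden n * z))%N%:Z.
      by rewrite -!subzn // !PoszD !PoszM; ring.
    by apply: rpredB.
  - by move: hx; rewrite /A -subzn //; lia.
  by lia.
rewrite natrM.
have hS : (\sum_(u < n1.+1 + A) smooth A (bin_pmf R n1) u) *
          (\sum_(v < n2.+1 + qden k) smooth (qden k) (bin_pmf R n2) v) <= 3 * 3.
  apply: ler_pM.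
  - by apply: sumr_ge0 => i _; apply: smooth_ge0; apply: bin_pmf_ge0.
  - by apply: sumr_ge0 => i _; apply: smooth_ge0; apply: bin_pmf_ge0.
  - by apply: (@sum_smooth_bin_pmf _ (qden l.+1)) => //; rewrite /A /n1 -/l; lia.
  - by apply: (@sum_smooth_bin_pmf _ (qden k)) => //; rewrite /n2; lia.
(* The 32 is 16 from [qden k.+1 <= 16 * qden k] times 2 from [qden l.+1 <= 2 * A]; then
   [288 = 3 * 3 * 32]. *)
have h : (qden n.+1 <= 32 * (A * qden k))%N.
  have := qden_add k l; rewrite nE; have := qden_leS k.
  have -> : (k == 0) = false by lia.
  move=> h1 h2.
  have h3 : (qden n.+1 <= qden l.+1 * (16 * qden k))%N.
    by apply: leq_trans (_ : qden l.+1 * qden k.+1 <= _)%N; [lia|rewrite leq_mul2l; lia].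
  apply: leq_trans h3 _.
  have h4 : (qden l.+1 <= 2 * A)%N by rewrite /A; lia.
  by have := leq_mul h4 (leqnn (qden k)); lia.
have AB0 : 0 < A%:R * (qden k)%:R :> R by rewrite mulr_gt0 ?ltr0n.
have p0' : 0 < (qden n.+1)%:R :> R by rewrite ltr0n.
rewrite ler_pdivrMr // (le_trans hS) // mulrAC ler_pdivlMr //.
have -> : 288 * (A%:R * (qden k)%:R) = 3 * 3 * (32 * (A * qden k))%:R :> R by rewrite !natrM; ring.
by apply: ler_wpM2l; [lra|rewrite ler_nat].
Qed.

(** Each value of [s %/ p] is taken [p] times, which cancels [1 / p]. The choice of [W] allows
    [a = 2 * U.+1] in [bin_pmf_variation], so the variation term adds at most 1 to the mass. *)
Lemma sum_envelope (n W V X : nat) (p := qden n.+1) (U := (4 * p ^ 3)%N) :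
  W = (4 * U.+1 ^ 2)%N ->
  \sum_(s < p * V) 288 / p%:R * shift_max U X (bin_pmf R W) (s %/ p) <= 576.
Proof.
move=> WE; have p0 : (0 < p)%N by apply: qden_gt0.
rewrite (@sum_divn _ (fun v => 288 / p%:R * shift_max U X (bin_pmf R W) v)) //.
rewrite -mulr_sumr mulrA mulrCA mulfV ?pnatr_eq0 -?lt0n // mulr1.
have -> : 576 = 288 * (1 + 1) :> R by ring.
apply: ler_wpM2l; first exact: ler0n.
apply: le_trans (sum_shift_max _ _ _ _) _.
apply: lerD; first exact: sum_bin_pmf_le.
have U0 : 0 < U.+1%:R :> R by rewrite ltr0n.
have a0 : 0 < 2 * U.+1%:R :> R by rewrite mulr_gt0.
apply: (@le_trans _ _ (U.+1%:R * (2 / (2 * U.+1%:R)))).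
  apply: ler_wpM2l => //; apply: bin_pmf_variation => //.
  by rewrite -natrM -natrX ler_nat WE expnMn.
by move: (U.+1%:R : R) U0 => u u0; rewrite invfM mulVKf ?divff ?gt_eqF.
Qed.

End Domination.

(** * Separation of the hypotheses *)

Section Trigonometry.
Variable R : realType.
Implicit Types x : R.

Lemma cos2_ge x : 0 <= x -> 1 - x ^+ 2 <= cos x ^+ 2.
Proof.
move=> x0; rewrite cos2sin2 lerD2l lerN2.
have [c _ ] := @MVT_segment R sin cos 0 x x0 (fun y _ => is_derive_sin y)
  (continuous_subspaceT (@continuous_sin R)).
by rewrite sin0 !subr0 => ->; rewrite exprMn ler_piMl ?sqr_ge0 //.
Qed.

(** Rests on [x cos x <= sin x], true because [sin y - y cos y] has derivative [y sin y >= 0]. The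
    reciprocal form suits high powers, through [expr_inv1D_le]. *)
Lemma cos2_le x : 0 <= x <= pi / 2 -> cos x ^+ 2 <= (1 + x ^+ 2)^-1.
Proof.
move=> /andP[x0 xpi].
have sx : x * cos x <= sin x.
  pose f (y : R) := sin y - y * cos y.
  have df (y : R) : is_derive y 1 f (y * sin y).
    by apply: is_derive_eq; rewrite /GRing.scale /=; ring.
  have cf : continuous f.
    by move=> y; apply: differentiable_continuous; apply/derivable1_diffP; case: (df y).
  have [c] := @MVT_segment R f (fun y => y * sin y) 0 x x0 (fun y _ => df y)
    (continuous_subspaceT cf).
  rewrite in_itv /= => /andP[c0 cx].
  rewrite /f sin0 mul0r !subr0 => h; rewrite -subr_ge0 h !mulr_ge0 //.
  by apply: sin_ge0_pi; rewrite c0 /=; have := pi_gt0 R; lra.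
have c0 : 0 <= cos x by apply: cos_ge0_pihalf; rewrite xpi andbT; lra.
have h0 : 0 < 1 + x ^+ 2 by rewrite ltr_pwDl // sqr_ge0.
rewrite -[leRHS]mul1r ler_pdivlMr // mulrDr mulr1 -exprMn mulrC.
have -> : 1 = cos x ^+ 2 + sin x ^+ 2 by rewrite cos2Dsin2.
by rewrite lerD2l lerXn2r // nnegrE ?mulr_ge0 // (le_trans _ sx) // mulr_ge0.
Qed.

Lemma cos2_addMpi x m : cos (x + pi *+ m) ^+ 2 = cos x ^+ 2.
Proof.
elim: m => [|m IH]; first by rewrite addr0.
by rewrite mulrSr addrA cosDpi sqrrN.
Qed.

Lemma expr_1B_ge (y : R) n : 0 <= y <= 1 -> 1 - n%:R * y <= (1 - y) ^+ n.
Proof.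
move=> /andP[y0 y1]; elim: n => [|n IH]; first by rewrite mul0r subr0 expr0.
have h : (1 - y) * (1 - n%:R * y) <= (1 - y) ^+ n.+1 by rewrite exprS ler_wpM2l // subr_ge0.
apply: le_trans h; rewrite -natr1 -subr_ge0.
have -> : (1 - y) * (1 - n%:R * y) - (1 - (n%:R + 1) * y) = n%:R * y ^+ 2 by ring.
by rewrite mulr_ge0 // sqr_ge0.
Qed.

Lemma expr_inv1D_le (y : R) n : 0 <= y -> (1 + y)^-1 ^+ n <= (1 + n%:R * y)^-1.
Proof.
move=> y0; rewrite exprVn lef_pV2 ?posrE ?exprn_gt0 ?ltr_wpDr ?mulr_ge0 //.
elim: n => [|n IH]; first by rewrite mul0r addr0 expr0.
have h : (1 + y) * (1 + n%:R * y) <= (1 + y) ^+ n.+1 by rewrite exprS ler_wpM2l // addr_ge0.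
apply: le_trans h; rewrite -natr1 -subr_ge0.
have -> : (1 + y) * (1 + n%:R * y) - (1 + (n%:R + 1) * y) = n%:R * y ^+ 2 by ring.
by rewrite mulr_ge0 // sqr_ge0.
Qed.

(** The characteristic function of a coin sum centred at its mean. The free phase carries the
    induction: one coin shifts it by [theta * w / 2] up or down, and the two cosines average to a
    product. *)
Lemma coinE_cos ws (theta phi : R) :
  coinE ws (fun t => cos (phi + theta * (t%:R - (sumn ws)%:R / 2))) =
  cos phi * \prod_(w <- ws) cos (theta * w%:R / 2).
Proof.
elim: ws phi => [|w ws IH] phi /=.
  by rewrite big_nil mulr1 mul0r subr0 mulr0 addr0.
rewrite (@eq_coinE _ ws _
  (fun t => cos ((phi - theta * w%:R / 2) + theta * (t%:R - (sumn ws)%:R / 2)))); last first.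
  by move=> t _; congr cos; rewrite natrD; field.
rewrite (@eq_coinE _ ws (fun t => cos (phi + theta * ((t + w)%N%:R - _)))
  (fun t => cos ((phi + theta * w%:R / 2) + theta * (t%:R - (sumn ws)%:R / 2)))); last first.
  by move=> t _; congr cos; rewrite !natrD; field.
by rewrite !IH big_cons cosB cosD; field.
Qed.

End Trigonometry.

Section Separation.
Variable R : realType.

(** With [p = qden n.+1] and up to multiples of [pi], the half-angle is [pi * qden k / p] for a step
    1, [pi * qden (n - k).+1 / p] for a step [qden n] by [qden_cross], and 0 for a step [p]. All
    multiplicities are even, so signs disappear. *)
Lemma prod_cos_hyp (W n k j : nat) (theta : R) : ~~ odd W -> (0 < k <= n)%N ->
  theta = 2 * (pi * ((qden k)%:R / (qden n.+1)%:R)) ->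
  \prod_(w <- hyp_steps W n j) cos (theta * w%:R / 2) =
  (cos (pi * ((qden k)%:R / (qden n.+1)%:R)) ^+ 2) ^+ (qden (n - j).+1 ^ 2) *
  (cos (pi * ((qden (n - k).+1)%:R / (qden n.+1)%:R)) ^+ 2) ^+ (qden j ^ 2).
Proof.
move=> oW /andP[k0 kn] ->.
have p0 : (qden n.+1)%:R != 0 :> R by rewrite pnatr_eq0 -lt0n; apply: qden_gt0.
have h2 : 2 * (pi * ((qden k)%:R / (qden n.+1)%:R)) * (qden n)%:R / 2 =
   pi * ((qden (n - k).+1)%:R / (qden n.+1)%:R) + pi *+ qden k.-1 :> R.
  have := qden_cross k.-1 (n - k).+1; rewrite prednK //.
  have -> : (k.-1 + (n - k).+1 = n)%N by lia.
  move=> /(congr1 (fun x => x%:R : R)); rewrite natrD !natrM => e.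
  have -> : (2 * (pi * ((qden k)%:R / (qden n.+1)%:R)) * (qden n)%:R / 2 =
    pi * ((qden k)%:R * (qden n)%:R) / (qden n.+1)%:R :> R) by field.
  by rewrite e -[pi *+ _]mulr_natr; field.
have h3 : 2 * (pi * ((qden k)%:R / (qden n.+1)%:R)) * (qden n.+1)%:R / 2 = 0 + pi *+ qden k :> R.
  by rewrite add0r -[pi *+ _]mulr_natr; field.
have h1 : 2 * (pi * ((qden k)%:R / (qden n.+1)%:R)) * 1 / 2 = pi * ((qden k)%:R / (qden n.+1)%:R) :> R.
  by field.
rewrite /hyp_steps !big_cat /= !big_nseq_cond /= !iter_mulr_1.
rewrite h1 h2 h3 mulrA !exprM cos2_addMpi.
have -> : W = (2 * W./2)%N by rewrite mul2n even_halfK.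
by rewrite exprM cos2_addMpi cos0 !expr1n mulr1.
Qed.

(** By [qden_add], both factors have an angle [x] and exponent [a ^ 2] with
    [a x <= pi / 14 <= 4 / 14]. Then [cos2_ge] and Bernoulli's inequality give at least
    [1 - (a x) ^ 2 >= 11 / 12] per factor. *)
Lemma prod_cos_hyp_self (W n k : nat) (theta : R) : ~~ odd W -> (0 < k <= n)%N ->
  theta = 2 * (pi * ((qden k)%:R / (qden n.+1)%:R)) ->
  3 / 4 <= \prod_(w <- hyp_steps W n k) cos (theta * w%:R / 2).
Proof.
move=> oW kn ht; rewrite (prod_cos_hyp k oW kn ht).
have hab : (14 * (qden (n - k).+1 * qden k) <= qden n.+1)%N.
  have := qden_add k (n - k); have -> : (k + (n - k) = n)%N by lia.
  have [g _] := qden_grow k; have [g' _] := qden_grow (n - k).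
  have := leq_mul (leqnn (qden (n - k).+1)) g.
  have : (qden (n - k) * qden k <= qden (n - k).+1 * qden k)%N by rewrite leq_mul2r; lia.
  by rewrite mulnA; lia.
have factor (a b : nat) : (14 * (a * b) <= qden n.+1)%N -> (0 < a)%N ->
    11 / 12 <= (cos (pi * (b%:R / (qden n.+1)%:R)) ^+ 2) ^+ (a ^ 2) :> R.
  move=> h a0.
  have p0 : 0 < (qden n.+1)%:R :> R by rewrite ltr0n; apply: qden_gt0.
  set x := pi * _; have x0 : 0 <= x by rewrite mulr_ge0 ?pi_ge0 // divr_ge0.
  have hx : (a%:R * x) ^+ 2 <= 1 / 12.
    have hr : a%:R * (b%:R / (qden n.+1)%:R) <= 1 / 14 :> R.
      rewrite mulrA ler_pdivrMr // -(ler_pM2l (ltr0n R 14)) -!natrM.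
      by rewrite mul1r mulrA mulfV ?pnatr_eq0 // mul1r ler_nat.
    have hax : a%:R * x <= 4 / 14.
      have -> : a%:R * x = pi * (a%:R * (b%:R / (qden n.+1)%:R)) by rewrite mulrCA.
      have -> : 4 / 14 = 4 * (1 / 14) :> R by field.
      apply: ler_pM => //; first exact: pi_ge0.
      by have := pihalf_lt2 R; lra.
    have : (a%:R * x) ^+ 2 <= (4 / 14) ^+ 2.
      by apply: lerXn2r hax; rewrite nnegrE; [apply: mulr_ge0|lra].
    by move=> /le_trans; apply; lra.
  have x1 : x ^+ 2 <= (a%:R * x) ^+ 2.
    apply: lerXn2r; rewrite ?nnegrE; [exact: x0|by apply: mulr_ge0|].
    by rewrite ler_peMl // ler1n.
  apply: (@le_trans _ _ ((1 - x ^+ 2) ^+ (a ^ 2))).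
    apply: (@le_trans _ _ (1 - (a ^ 2)%:R * x ^+ 2)).
      by rewrite natrX -exprMn; lra.
    by apply: expr_1B_ge; rewrite sqr_ge0; lra.
  by rewrite lerXn2r // ?nnegrE ?sqr_ge0 ?cos2_ge //; lra.
apply: (@le_trans _ _ (11 / 12 * (11 / 12))); first by lra.
apply: ler_pM; try lra; apply: factor => //; [exact: qden_gt0| |by apply: qden_gt0; lia].
by rewrite [(qden k * _)%N]mulnC.
Qed.

(** One factor suffices: the first when [j < k], the second when [j > k]. There [a * b >= qden n.+1]
    by [qden_add], so [a x >= pi >= 2] and the factor is at most [1 / (1 + 4)]. *)
Lemma prod_cos_hyp_other (W n k j : nat) (theta : R) : ~~ odd W ->
  (0 < k <= n)%N -> (0 < j <= n)%N -> j != k ->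
  theta = 2 * (pi * ((qden k)%:R / (qden n.+1)%:R)) ->
  0 <= \prod_(w <- hyp_steps W n j) cos (theta * w%:R / 2) <= 1 / 4.
Proof.
move=> oW kn jn jk ht; rewrite (prod_cos_hyp j oW kn ht).
have p0 : 0 < (qden n.+1)%:R :> R by rewrite ltr0n; apply: qden_gt0.
have factor (a b : nat) : (qden n.+1 <= a * b)%N -> (2 * b <= qden n.+1)%N ->
    (cos (pi * (b%:R / (qden n.+1)%:R)) ^+ 2) ^+ (a ^ 2) <= 1 / 4 :> R.
  move=> h hb.
  set x := pi * _; have x0 : 0 <= x by rewrite mulr_ge0 ?pi_ge0 // divr_ge0.
  have xpi : x <= pi / 2.
    rewrite ler_pM2l ?pi_gt0 // ler_pdivrMr // -(ler_pM2l (ltr0n R 2)) mulrA.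
    by rewrite mulfV ?pnatr_eq0 // mul1r -natrM ler_nat.
  apply: (@le_trans _ _ ((1 + x ^+ 2)^-1 ^+ (a ^ 2))).
    rewrite lerXn2r // ?nnegrE ?sqr_ge0 // ?invr_ge0 ?addr_ge0 ?sqr_ge0 //.
    by rewrite cos2_le // x0.
  apply: (le_trans (expr_inv1D_le _ (sqr_ge0 x))).
  have hax : 2 <= a%:R * x.
    have -> : a%:R * x = pi * (a%:R * (b%:R / (qden n.+1)%:R)) by rewrite mulrCA.
    have -> : 2 = 2 * 1 :> R by rewrite mulr1.
    apply: ler_pM => //; first exact: pi_ge2.
    by rewrite mulrA ler_pdivlMr // mul1r -natrM ler_nat.
  have h4 : 4 <= (a%:R * x) ^+ 2.
    have -> : 4 = 2 ^+ 2 :> R by ring.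
    by rewrite lerXn2r // nnegrE; lra.
  rewrite natrX -exprMn mul1r lef_pV2 ?posrE; lra.
set c1 := cos _ ^+ 2; set c2 := cos _ ^+ 2.
have c10 : 0 <= c1 by apply: sqr_ge0.
have c20 : 0 <= c2 by apply: sqr_ge0.
have c11 : c1 <= 1 by rewrite -[c1]real_normK ?num_real // exprn_ile1 // cos_max.
have c21 : c2 <= 1 by rewrite -[c2]real_normK ?num_real // exprn_ile1 // cos_max.
apply/andP; split; first by apply: mulr_ge0; exact: exprn_ge0.
(* Keeps the angle in [[0, pi / 2]], where [cos2_le] applies. *)
have small b : (b <= n)%N -> (2 * qden b <= qden n.+1)%N.
  move=> bn; apply: leq_trans (_ : qden b.+1 <= _)%N; last exact: qden_mono.
  by have := qden_grow b; lia.
have [jk'|jk'] := ltnP j k.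
  apply: (@le_trans _ _ (c1 ^+ (qden (n - j).+1 ^ 2))).
    by apply: ler_piMr; [exact: exprn_ge0|exact: exprn_ile1].
  apply: factor; last by apply: small; lia.
  have := qden_add k.-1 (n - k).+1; have -> : (k.-1 + (n - k).+1 = n)%N by lia.
  rewrite prednK; last by lia.
  have : (qden (n - k).+2 * qden k <= qden (n - j).+1 * qden k)%N.
    by rewrite leq_mul2r qden_mono ?orbT //; lia.
  by lia.
apply: (@le_trans _ _ (c2 ^+ (qden j ^ 2))).
  by apply: ler_piMl; [exact: exprn_ge0|exact: exprn_ile1].
apply: factor; last by apply: small; lia.
have := qden_add k (n - k); have -> : (k + (n - k) = n)%N by lia.
have : (qden k.+1 * qden (n - k).+1 <= qden j * qden (n - k).+1)%N.
  by rewrite leq_mul2r qden_mono ?orbT //; lia.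
by lia.
Qed.

(** The cosine of frequency [theta] centred at the mean of the [k]-th hypothesis is a test function
    bounded by 1, with expectation at least 3/4 there and at most 1/4 under the [j]-th. *)
Lemma hyp_separated (W n k j S : nat) : ~~ odd W ->
  (0 < k <= n)%N -> (0 < j <= n)%N -> j != k ->
  (sumn (hyp_steps W n k) < S)%N -> (sumn (hyp_steps W n j) < S)%N ->
  1 / 2 <= \sum_(i < S) `|coin_pmf R (hyp_steps W n k) i%:Z - coin_pmf R (hyp_steps W n j) i%:Z|.
Proof.
move=> oW kn jn jk kS jS.
pose theta : R := 2 * (pi * ((qden k)%:R / (qden n.+1)%:R)).
pose f (t : nat) : R := cos (theta * (t%:R - (sumn (hyp_steps W n k))%:R / 2)).
have Ek : coinE (hyp_steps W n k) f = \prod_(w <- hyp_steps W n k) cos (theta * w%:R / 2).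
  rewrite -[RHS]mul1r -[X in X * _]cos0 -coinE_cos.
  by apply: eq_coinE => t _; rewrite add0r.
(* Phase caused by the difference of the two means; as the product is nonnegative, bounding its
   cosine by 1 suffices. *)
pose phi := theta * ((sumn (hyp_steps W n j))%:R / 2 - (sumn (hyp_steps W n k))%:R / 2).
have Ej : coinE (hyp_steps W n j) f = cos phi * \prod_(w <- hyp_steps W n j) cos (theta * w%:R / 2).
  rewrite -coinE_cos; apply: eq_coinE => t _; rewrite /f /phi; congr cos; ring.
have := prod_cos_hyp_self oW kn (erefl theta); rewrite -Ek.
have /andP[] := prod_cos_hyp_other oW kn jn jk (erefl theta).
set PJ := \prod_(w <- _) _ => PJ0 PJ1 hk.
have hj : coinE (hyp_steps W n j) f <= PJ by rewrite Ej ler_piMl // cos_le1.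
apply: (@le_trans _ _ (coinE (hyp_steps W n k) f - coinE (hyp_steps W n j) f)); first by lra.
rewrite -(sum_coin_pmf f kS) -(sum_coin_pmf f jS) -sumrB; apply: ler_sum => i _.
rewrite -mulrBr; apply: le_trans (ler_norm _) _; rewrite normrM ler_piMl //.
exact: cos_max.
Qed.

End Separation.

(** * Reduction to finite sums *)

Local Open Scope classical_set_scope.

Section FinitelySupportedSums.
Variable R : realType.

Lemma esum_point (T : choiceType) (t : T) (c : \bar R) : (0 <= c)%E ->
  \esum_(z in [set: T]) (if z == t then c else 0)%E = c.
Proof.
move=> c0; rewrite -[RHS](@esum_set1 R T t (fun=> c)) // [RHS]esum_mkcond.
apply: eq_esum => z _; case: eqP => [->|zt]; first by rewrite mem_set.
by rewrite memNset.
Qed.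

Variables (T : choiceType) (I : finType) (e : I -> T) (F : T -> \bar R).
Hypotheses (e_inj : injective e) (F0 : forall t, (0 <= F t)%E).

(** The restriction of [F] to the image of [e], written as a finite sum of point masses so that
    [esum_sum] applies. *)
Let F' z := (\sum_i (if z == e i then F (e i) else 0))%E.

Let F'E i : F' (e i) = F (e i).
Proof.
rewrite /F' (bigD1 i) //= eqxx big1 ?adde0 // => j ji.
by case: eqP => // /e_inj ij; rewrite ij eqxx in ji.
Qed.

Let F'0 z : (forall i, z <> e i) -> F' z = 0%E.
Proof. by move=> h; rewrite /F' big1 // => i _; case: eqP => // /h. Qed.

Let esumF' : \esum_(z in [set: T]) F' z = (\sum_i F (e i))%E.
Proof.
rewrite /F' esum_sum; last by move=> z i _ _; case: ifP.
by apply: eq_bigr => i _; rewrite esum_point.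
Qed.

Lemma le_sum_esum : (\sum_i F (e i) <= \esum_(z in [set: T]) F z)%E.
Proof.
rewrite -esumF'; apply: le_esum => z _.
have [[i ->]|h] := pselect (exists i, z = e i); first by rewrite F'E.
by rewrite F'0 // => i zi; apply: h; exists i.
Qed.

Lemma esum_sum_inj : (forall t, (forall i, t <> e i) -> F t = 0%E) ->
  \esum_(z in [set: T]) F z = (\sum_i F (e i))%E.
Proof.
move=> hF; rewrite -esumF'; apply: eq_esum => z _.
have [[i ->]|h] := pselect (exists i, z = e i); first by rewrite F'E.
by rewrite F'0 ?hF // => i zi; apply: h; exists i.
Qed.

End FinitelySupportedSums.

(** * Coin sums as sums over a finite set of values *)

Section CoinFamilies.
Variable R : realType.

(** The list is reversed because [sumdist] splits off the last index and [coinE] the head. A weight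
    0 gives the point mass at 0. *)
Definition coin_family (ws : seq nat) (i : nat) (x : int) : R :=
  ((x == 0)%:R + (x == (nth 0%N (rev ws) i)%:Z)%:R) / 2.

Lemma coin_family_Asum (A : seq int) ws : 0 \in A -> (forall w, w \in ws -> w%:Z \in A) ->
  is_Asum_family A (size ws) (coin_family ws).
Proof.
move=> A0 Aw i iN; rewrite /coin_family; set w := nth _ _ _.
have wA : w%:Z \in A.
  by apply: Aw; rewrite -mem_rev mem_nth // size_rev.
split; last first.
  move=> z zA; have -> : (z == 0) = false by apply/eqP => z0; rewrite z0 A0 in zA.
  have -> : (z == w%:Z) = false by apply/eqP => z0; rewrite z0 wA in zA.
  by rewrite addr0 mul0r.
split=> [z|]; first by rewrite divr_ge0 // addr_ge0.
rewrite (@eq_esum _ _ _ _ (fun z : int => (if z == 0%R then (2^-1 : R)%:E else 0) +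
  (if z == w%:Z then (2^-1 : R)%:E else 0))%E); last first.
  move=> z _; case: (z == 0); case: (z == w%:Z);
    rewrite /= ?adde0 ?add0e -?EFinD ?addr0 ?add0r ?mul0r ?mul1r //.
  by congr (_%:E); field.
rewrite esumD; [|by move=> z _; case: ifP|by move=> z _; case: ifP].
by rewrite !esum_point // -EFinD; congr (_%:E); field.
Qed.

Lemma eq_sumdist (A : seq int) (q q' : nat -> int -> R) n :
  (forall i, (i < n)%N -> q i =1 q' i) -> sumdist A q n =1 sumdist A q' n.
Proof.
elim: n => [|n IH] h z //=; apply: eq_bigr => x _; rewrite h // IH // => i ni.
by apply: h; lia.
Qed.

Lemma sum_undup_point (A : seq int) (a : int) (F : int -> R) : a \in A ->
  \sum_(x <- undup A) (x == a)%:R * F x = F a.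
Proof.
move=> aA; rewrite (bigD1_seq a) ?mem_undup ?undup_uniq //= eqxx mul1r big1 ?addr0 //.
by move=> x /negbTE ->; rewrite mul0r.
Qed.

Lemma sumdist_coin (A : seq int) ws : 0 \in A -> (forall w, w \in ws -> w%:Z \in A) ->
  sumdist A (coin_family ws) (size ws) =1 coin_pmf R ws.
Proof.
move=> A0; elim: ws => [|w ws IH] Aw z; first by rewrite /= /coin_pmf /= eq_sym; case: eqP.
have E : sumdist A (coin_family (w :: ws)) (size ws) =1 coin_pmf R ws.
  move=> y; rewrite -IH; last by move=> v vws; apply: Aw; rewrite inE vws orbT.
  apply: eq_sumdist => i iws x; rewrite /coin_family rev_cons nth_rcons size_rev iws //.
rewrite /=; under eq_bigr => x _.
  rewrite E /coin_family rev_cons nth_rcons size_rev ltnn eqxx mulrAC -mulrA mulrDl.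
  over.
rewrite big_split /= (sum_undup_point (fun x => coin_pmf R ws (z - x) / 2)) //.
rewrite (sum_undup_point (fun x => coin_pmf R ws (z - x) / 2)); last by apply: Aw; rewrite inE eqxx.
rewrite -mulrDl subr0 /coin_pmf /=; congr ((_ + _) / 2).
by apply: eq_coinE => t _; rewrite PoszD [in LHS]eq_sym subr_eq [in LHS]eq_sym.
Qed.

End CoinFamilies.

(** * From learning to packing *)

Section Packing.
Variable R : realType.

Lemma dTV_sum_le (a p : int -> R) (eps : R) S : (dTV a p <= eps%:E)%E ->
  \sum_(i < S) `|a i%:Z - p i%:Z| <= 2 * eps.
Proof.
rewrite /dTV => h; rewrite -lee_fin -sumEFin.
have inj : injective (fun i : 'I_S => i%:Z) by move=> i j [] /val_inj.
apply: (le_trans (@le_sum_esum R _ _ _ (fun z => (`|a z - p z|)%:E) inj _)).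
  by move=> z; rewrite lee_fin.
have -> : (2 * eps)%:E = (2%:E * eps%:E)%E by rewrite EFinM.
by rewrite -lee_pdivrMl.
Qed.

Lemma dTV_common_sum_le (a p p' : int -> R) (eps : R) S :
  (dTV a p <= eps%:E)%E -> (dTV a p' <= eps%:E)%E ->
  \sum_(i < S) `|p i%:Z - p' i%:Z| <= 4 * eps.
Proof.
move=> /(dTV_sum_le S) h /(dTV_sum_le S) h'.
have -> : 4 * eps = 2 * eps + 2 * eps by ring.
apply: le_trans (lerD h h'); rewrite -big_split /=; apply: ler_sum => i _.
by apply: le_trans (ler_distD (a i%:Z) _ _) _; rewrite [X in X + _ <= _]distrC.
Qed.

(** For a fixed sample the success events of different hypotheses are disjoint, so their
    probabilities add up to at most 1. Summing over [k] and bounding each likelihood by a product of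
    values of [h] leaves a sum over samples that factors as an [m]-th power. *)
Lemma learns_packing (A : seq int) (N : nat) (eps C : R) (m : nat) (d : measure_display)
    (T : measurableType d) (P : probability T R) (alg : m.-tuple int -> T -> int -> R)
    (K S : nat) (q : 'I_K -> nat -> int -> R) (h : nat -> R) :
  (0 < K)%N -> learns A N eps P alg ->
  (forall k, is_Asum_family A N (q k)) ->
  (forall k z, 0 <= sumdist A (q k) N z) ->
  (forall k z, ~~ (0 <= z < S%:Z) -> sumdist A (q k) N z = 0) ->
  (forall k (i : nat), (i < S)%N -> sumdist A (q k) N i%:Z <= h i) ->
  \sum_(i < S) h i <= C ->
  (forall k j, k != j ->
     4 * eps < \sum_(i < S) `|sumdist A (q k) N i%:Z - sumdist A (q j) N i%:Z|) ->
  K%:R * (9 / 10) <= C ^+ m.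
Proof.
move=> K0 [_ L] qA p0 pS ph hC sep.
pose p k := sumdist A (q k) N.
have [G HG] := choice (fun k => L (q k) (qA k)).
pose e (f : {ffun 'I_m -> 'I_S}) : m.-tuple int := [tuple (f i)%:Z | i < m].
have e_inj : injective e.
  move=> f g fg; apply/ffunP => i; apply/val_inj.
  by have := congr1 (fun t => tnth t i) fg; rewrite !tnth_mktuple => -[].
have mG k s : measurable (G k s) by have [/(_ s)[]] := HG k.
(* An output within [eps] of two hypotheses would put them within [4 * eps] in [l^1]. *)
have dG s : trivIset setT (fun k => G k s).
  move=> k j _ _ [t [tk tj]]; apply/eqP/negPn/negP => kj.
  have [/(_ s)[_ Gk] _] := HG k; have [/(_ s)[_ Gj] _] := HG j.
  by have := dTV_common_sum_le S (Gk _ tk) (Gj _ tj); rewrite leNgt sep.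
pose g k f := fine (P (G k (e f))).
have gE k f : P (G k (e f)) = (g k f)%:E by rewrite fineK // fin_num_measure.
have g1 f : \sum_k g k f <= 1.
  rewrite -lee_fin -sumEFin; under eq_bigr do rewrite -gE.
  rewrite -(@measure_bigsetU_ord _ _ _ P _ xpredT (fun k => G k (e f))) //.
  by apply: probability_le1; apply: bigsetU_measurable.
have g0 k f : 0 <= g k f by rewrite fine_ge0.
(* Every hypothesis lives on [[0, S)], so only samples in the image of [e] carry weight. *)
have win k : 9 / 10 <= \sum_(f : {ffun 'I_m -> 'I_S}) (\prod_(i < m) p k (f i)%:Z) * g k f.
  have [_] := HG k; rewrite (@esum_sum_inj R _ _ e) //.
  - rewrite -lee_fin -sumEFin => /le_trans; apply; rewrite le_eqVlt; apply/orP; left.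
    apply/eqP/eq_bigr => f _; rewrite gE -EFinM; congr (_ * _)%:E.
    by apply: eq_bigr => i _; rewrite tnth_mktuple.
  - by move=> t; rewrite mule_ge0 // lee_fin prodr_ge0.
  move=> t ht.
  have [i ti] : exists i, ~~ (0 <= tnth t i < S%:Z).
    apply: contrapT => /forallNP H; pose u i := `|tnth t i|%N.
    have tS i : (u i < S)%N by have /negP/negPn := H i; rewrite /u; lia.
    apply: (ht [ffun i => Ordinal (tS i)]); apply: eq_from_tnth => i.
    rewrite tnth_mktuple ffunE /= /u gez0_abs //.
    by have /negP/negPn/andP[] := H i.
  by rewrite (bigD1 i) //= pS // mul0r mul0e.
have pm k (f : {ffun 'I_m -> 'I_S}) : \prod_(i < m) p k (f i)%:Z <= \prod_(i < m) h (f i).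
  by apply: ler_prod => i _; rewrite p0 ph.
have h0 (i : nat) : (i < S)%N -> 0 <= h i.
  by move=> iS; apply: le_trans (ph (Ordinal K0) i iS).
apply: (@le_trans _ _ (\sum_(k < K) \sum_(f : {ffun 'I_m -> 'I_S}) (\prod_(i < m) p k (f i)%:Z) * g k f)).
  rewrite mulr_natl -[X in _ *+ X]card_ord -sumr_const; apply: ler_sum => k _; exact: win.
rewrite exchange_big /=.
apply: (@le_trans _ _ (\sum_(f : {ffun 'I_m -> 'I_S}) \prod_(i < m) h (f i))).
  apply: ler_sum => f _.
  apply: (@le_trans _ _ (\sum_(k < K) (\prod_(i < m) h (f i)) * g k f)).
    by apply: ler_sum => k _; apply: ler_wpM2r.
  rewrite -mulr_sumr ler_piMr // prodr_ge0 // => i _; exact: h0.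
rewrite -(bigA_distr_bigA (fun (_ : 'I_m) (j : 'I_S) => h j)) /= prodr_const card_ord.
rewrite lerXn2r // nnegrE; last first.
  by apply: le_trans hC; apply: sumr_ge0 => i _; apply: h0.
by apply: sumr_ge0 => i _; apply: h0.
Qed.

End Packing.

(** * The bound on the number of samples *)

Lemma size_hyp_le (W n k : nat) : (k <= n)%N ->
  (size (hyp_steps W n k) <= W + 4 * qden n.+1 ^ 2)%N.
Proof.
move=> kn; rewrite /hyp_steps !size_cat !size_nseq.
have h1 : (qden (n - k).+1 ^ 2 <= qden n.+1 ^ 2)%N by rewrite leq_sqr; apply: qden_mono; lia.
have h2 : (qden k ^ 2 <= qden n.+1 ^ 2)%N by rewrite leq_sqr; apply: qden_mono; lia.
lia.
Qed.

Lemma mem_hyp (W n k w : nat) : w \in hyp_steps W n k ->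
  [|| w == 1, w == qden n | w == qden n.+1]%N.
Proof. by rewrite !mem_cat !mem_nseq => /or3P[] /andP[_ ->]; rewrite ?orbT. Qed.

Lemma learns_hyp_bound (R : realType) (n N m : nat) (W := (4 * (4 * qden n.+1 ^ 3).+1 ^ 2)%N)
    (d : measure_display) (T : measurableType d) (P : probability T R)
    (alg : m.-tuple int -> T -> int -> R) :
  (0 < n)%N -> (W + 4 * qden n.+1 ^ 2 <= N)%N ->
  learns [:: 0; 1; (qden n)%:Z; (qden n.+1)%:Z] N (1 / 10) P alg ->
  n%:R * (9 / 10) <= 576 ^+ m :> R.
Proof.
move=> n0 hN L; set A := [:: 0; _; _; _] in L.
pose p := qden n.+1; pose U := (4 * p ^ 3)%N; pose V := (W + U).+1.
have p0 : (0 < p)%N by apply: qden_gt0.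
(* Zeros pad the list to exactly [N] summands; the ordinal [k] stands for the index [k.+1], between
   1 and [n]. *)
pose ws (k : 'I_n) := nseq (N - size (hyp_steps W n k.+1)) 0%N ++ hyp_steps W n k.+1.
have kn (k : 'I_n) : (0 < k.+1 <= n)%N by rewrite ltn_ord.
have size_ws k : size (ws k) = N.
  by rewrite size_cat size_nseq subnK // (leq_trans _ hN) // size_hyp_le.
have wsA k w : w \in ws k -> w%:Z \in A.
  rewrite mem_cat mem_nseq => /orP[/andP[_ /eqP ->]|/mem_hyp]; first by rewrite inE eqxx.
  by rewrite !inE !eqz_nat => /or3P[] ->; rewrite ?orbT.
have A0 : 0 \in A by rewrite inE eqxx.
have pE k z : sumdist A (coin_family R (ws k)) N z = coin_pmf R (hyp_steps W n k.+1) z.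
  by rewrite -(size_ws k) sumdist_coin //; [apply: coinE_nseq0 | apply: wsA].
have sumS (k : 'I_n) : (sumn (hyp_steps W n k.+1) < p * V)%N.
  have /andP[_ h] := kn k; apply: leq_ltn_trans (sumn_hyp W h) _.
  rewrite /V mulnS mulnDr -/p -/U.
  have : (U <= p * U)%N by rewrite leq_pmull.
  by lia.
have oW : ~~ odd W by rewrite /W oddM.
apply: (@learns_packing R A N (1 / 10) 576 m d T P alg n (p * V) (fun k => coin_family R (ws k))
  (fun s => 288 / p%:R * shift_max U V (bin_pmf R W) (s %/ p))) => //.
- by move=> k; rewrite -[N](size_ws k); apply: coin_family_Asum => //; apply: wsA.
- by move=> k z; rewrite pE; apply: coin_pmf_ge0.
- by move=> k z hz; rewrite pE coin_pmf_out //; have := sumS k; lia.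
- move=> k i iS; rewrite pE; apply: hyp_dominated => //.
  by rewrite -/p ltnW // ltn_divLR // mulnC.
- exact: sum_envelope.
move=> k j kj; under eq_bigr do rewrite !pE.
(* Here [4 * eps = 2 / 5], below the separation [1 / 2]. *)
apply: lt_le_trans (_ : 1 / 2 <= _); first by lra.
by apply: hyp_separated => //; rewrite eqSS eq_sym.
Qed.

(** From [qden n.+1 <= 16 ^ n.+1], its logarithm is at most [15 * n.+1], which for [n >= 100] is
    below [(9 n / 10) ^ 2 <= C ^ (2 m)]. *)
Lemma ln_ln_qden_le (R : realType) (C : R) (n m : nat) : 1 < C -> (100 <= n)%N ->
  n%:R * (9 / 10) <= C ^+ m -> ln (ln ((qden n.+1)%:R : R)) <= m%:R * (2 * ln C).
Proof.
move=> C1 n100 nm; have C0 : 0 < C by apply: lt_trans C1.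
have n100R : 100 <= n%:R :> R by rewrite ler_nat.
have Q1 : 1 < (qden n.+1)%:R :> R by rewrite ltr1n; have := qden_ge n.+1; lia.
have lnQ : ln ((qden n.+1)%:R : R) <= C ^+ (2 * m).
  apply: (@le_trans _ _ (n.+1%:R * 15)).
    apply: (@le_trans _ _ (ln (16 ^+ n.+1))).
      by rewrite ler_ln ?posrE ?exprn_gt0 //; [rewrite -natrX ler_nat qden_le_exp|lra].
    rewrite lnXn // -[leLHS]mulr_natl ler_wpM2l //.
    have -> : 16 = 1 + 15 :> R by ring.
    by apply: le_ln1Dx; lra.
  apply: (@le_trans _ _ ((n%:R * (9 / 10)) ^+ 2)); first by rewrite -natr1; nra.
  rewrite mulnC exprM; apply: lerXn2r nm; rewrite nnegrE; last by rewrite exprn_ge0 // ltW.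
  by lra.
apply: (@le_trans _ _ (ln (C ^+ (2 * m)))).
  by rewrite ler_ln ?posrE ?exprn_gt0 // ln_gt0.
by rewrite lnXn // -[leLHS]mulr_natl natrM -mulrA mulrCA.
Qed.

Theorem theorem5 (R : realType) :
  exists (eps0 c : R), 0 < eps0 /\ 0 < c /\
  forall M : int, exists a1 a2 a3 a4 : int,
    [/\ 0 <= a1, a1 < a2, a2 < a3, a3 < a4 & M <= a4] /\
    exists N0 : nat, forall N : nat, (N0 <= N)%N ->
      forall (m : nat) (d : measure_display) (T : measurableType d)
             (P : probability T R) (alg : m.-tuple int -> T -> int -> R),
        learns [:: a1; a2; a3; a4] N eps0 P alg ->
        c * ln (ln (a4%:~R : R)) <= m%:R.
Proof.
have ln576 : 0 < ln (576 : R) by apply: ln_gt0; rewrite ltr1n.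
exists (1 / 10), (2 * ln 576)^-1; split; first by lra.
split; first by rewrite invr_gt0 mulr_gt0.
(* By [qden_ge], the summand [|M|] makes the last value at least [M]; the 100 is for
   [ln_ln_qden_le]. *)
move=> M; pose n := (`|M| + 100)%N.
exists 0, 1, (qden n)%:Z, (qden n.+1)%:Z; split.
  have hn := qden_ge n; have hn1 := qden_ge n.+1; have [g _] := qden_grow n.
  by rewrite /n in hn hn1 g *; split => //; lia.
exists (4 * (4 * qden n.+1 ^ 3).+1 ^ 2 + 4 * qden n.+1 ^ 2)%N => N hN m d T P alg L.
have n100 : (100 <= n)%N by rewrite /n leq_addl.
rewrite mulrC ler_pdivrMr ?mulr_gt0 // -pmulrn.
apply: (ln_ln_qden_le _ n100); first by rewrite ltr1n.
by apply: (learns_hyp_bound _ hN L); lia.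
Qed.
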